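(* Suppose each $f_i$ is $l$-smooth and $f=\frac1n\sum_{i=1}^n f_i$ is nonconvex in $x$ and $\mu$-strongly concave in $y$, with condition number $\kappa=l/\mu\ge 1$ (in the precise sense given in the context). If $\lambda=4$, the step sizes satisfy $\eta_2\le \frac{1}{8l}$ and $\eta_1=\frac{\eta_2}{r}$ with $r\ge 14\kappa^2$, then for any integer $T>0$, the Shuffling Gradient Descent-Ascent with Variance Reduction algorithm achieves $$\frac{1}{T+1}\sum_{t=0}^{T}\mathbb{E}\left[\|\nabla\Phi(x_t)\|^2\right]\le \frac{\mathcal{P}_{\lambda}(x_0,y_0)}{(T+1)\eta_1}=\mathcal{O}\left(\frac{rl}{T+1}\right).$$
   Context: Problem: $\min_{x\in\mathbb{R}^d}\max_{y\in\mathbb{R}^d} f(x,y):=\frac1n\sum_{i=1}^n f_i(x,y)$, with $f_i:\mathbb{R}^d\times\mathbb{R}^d\to\mathbb{R}$ differentiable. $\|\cdot\|$ is the Euclidean norm. Standing assumptions: (i) each $f_i$ is $l$-smooth, i.e. $\|\nabla f_i(x_1,y_1)-\nabla f_i(x_2,y_2)\|\le l(\|x_1-x_2\|+\|y_1-y_2\|)$ for all $x_1,x_2,y_1,y_2$; (ii) $f$ is nonconvex in $x$ (no convexity in $x$ is required) and $\mu$-strongly concave in $y$, with condition number $\kappa:=l/\mu\ge1$. Notation: $\Phi(x):=\max_{y\in\mathbb{R}^d} f(x,y)$; it is differentiable with $\nabla\Phi(x)=\nabla_x f(x,y^*(x))$, where $y^*(x)$ is the unique maximizer of $f(x,\cdot)$.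 $\Phi^*$ is the (finite) infimum of $\Phi$ over $\mathbb{R}^d$. For $\lambda>0$ the potential function is $\mathcal{P}_\lambda(x,y):=\lambda(\Phi(x)-\Phi^* )+\Phi(x)-f(x,y)$. Algorithm (Shuffling Gradient Descent-Ascent with Variance Reduction): start from given $x_0,y_0\in\mathbb{R}^d$ with step sizes $\eta_1,\eta_2>0$. In each epoch $t=0,1,\ldots,T$ a permutation $\pi=(\pi^0,\ldots,\pi^{n-1})$ of $\{1,\ldots,n\}$ is used: under IG (incremental gradient) it is a fixed deterministic permutation; under SO (shuffling once) it is a random permutation drawn once at the start and reused in all epochs; under RR (random reshuffling) a new random permutation is drawn at the start of each epoch. Any of these three schemes may be used. Set $x_t^0=x_t$, $y_t^0=y_t$, and for $j=0,\ldots,n-1$ compute $$h_t^j=\nabla_x f(x_t,y_t)+\nabla_x f_{\pi^j}(x_t^j,y_t^j)-\nabla_x f_{\pi^j}(x_t,y_t),\qquad x_t^{j+1}=x_t^j-\tfrac{\eta_1}{n}h_t^j,$$ $$d_t^j=\nabla_y f(x_t,y_t)+\nabla_y f_{\pi^j}(x_t^j,y_t^j)-\nabla_y f_{\pi^j}(x_t,y_t),\qquad y_t^{j+1}=y_t^j+\tfrac{\eta_2}{n}d_t^j.$$ Then set $x_{t+1}=x_t^n$, $y_{t+1}=y_t^n$. The expectation $\mathbb{E}$ is over the random permutations. *)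

(* Defs.v *)
From HB Require Import structures.
From mathcomp Require Import all_boot all_order all_algebra all_fingroup.
From mathcomp Require Import all_classical all_reals all_analysis.

Set Implicit Arguments.
Unset Strict Implicit.
Unset Printing Implicit Defensive.

Import Order.TTheory GRing.Theory Num.Theory.
Import numFieldNormedType.Exports.

Local Open Scope classical_set_scope.
Local Open Scope ring_scope.

(* The library norm on 'rV[R]_d is the sup norm, hence this definition.  The
   two norms induce the same topology, so that the library's notions of
   differentiability and derivative apply unchanged. *)
Definition norm2 (R : realType) (d : nat) (v : 'rV[R]_d) : R :=
  Num.sqrt (\sum_(j < d) v 0 j ^+ 2).

Definition grad (R : realType) (d : nat) (g : 'rV[R]_d -> R) (x : 'rV[R]_d) :
  'rV[R]_d := \row_(j < d) 'D_(delta_mx 0 j) g x.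

Definition gradx (R : realType) (d : nat) (g : 'rV[R]_d -> 'rV[R]_d -> R)
  (x y : 'rV[R]_d) : 'rV[R]_d := grad (fun x' => g x' y) x.

Definition grady (R : realType) (d : nat) (g : 'rV[R]_d -> 'rV[R]_d -> R)
  (x y : 'rV[R]_d) : 'rV[R]_d := grad (g x) y.

Definition smooth (R : realType) (d : nat) (l : R)
    (g : 'rV[R]_d -> 'rV[R]_d -> R) : Prop :=
  (forall p : 'rV[R]_d * 'rV[R]_d,
      differentiable (fun q : 'rV[R]_d * 'rV[R]_d => g q.1 q.2) p) /\
  forall x1 y1 x2 y2 : 'rV[R]_d,
    norm2 (row_mx (gradx g x1 y1) (grady g x1 y1) -
           row_mx (gradx g x2 y2) (grady g x2 y2))
    <= l * (norm2 (x1 - x2) + norm2 (y1 - y2)).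

Definition strongly_concave (R : realType) (d : nat) (mu : R)
    (g : 'rV[R]_d -> R) : Prop :=
  forall (y1 y2 : 'rV[R]_d) (s : R), 0 <= s <= 1 ->
    s * g y1 + (1 - s) * g y2
      + mu / 2 * (s * (1 - s)) * norm2 (y1 - y2) ^+ 2
    <= g (s *: y1 + (1 - s) *: y2).

Definition avg (R : realType) (d n : nat)
    (f_ : 'I_n -> 'rV[R]_d -> 'rV[R]_d -> R) (x y : 'rV[R]_d) : R :=
  n%:R^-1 * \sum_(i < n) f_ i x y.

(* When f x is strongly concave (and differentiable) this supremum is attained,
   so it is the maximum over y; [sup] and [inf] carry no information on
   unbounded sets. *)
Definition Phi (R : realType) (d : nat) (f : 'rV[R]_d -> 'rV[R]_d -> R)
  (x : 'rV[R]_d) : R := sup (range (f x)).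

Definition Phi_inf (R : realType) (d : nat)
  (f : 'rV[R]_d -> 'rV[R]_d -> R) : R := inf (range (Phi f)).

Definition potential (R : realType) (d : nat) (lambda : R)
    (f : 'rV[R]_d -> 'rV[R]_d -> R) (x y : 'rV[R]_d) : R :=
  lambda * (Phi f x - Phi_inf f) + Phi f x - f x y.

(* [z0] is the iterate (x_t, y_t) at the start of the epoch, [z] is
   (x_t^j, y_t^j) and [i] is pi^j. *)
Definition vr_step (R : realType) (d n : nat)
    (f_ : 'I_n -> 'rV[R]_d -> 'rV[R]_d -> R) (eta1 eta2 : R)
    (z0 z : 'rV[R]_d * 'rV[R]_d) (i : 'I_n) : 'rV[R]_d * 'rV[R]_d :=
  let f := avg f_ in
  let h := gradx f z0.1 z0.2 + gradx (f_ i) z.1 z.2 - gradx (f_ i) z0.1 z0.2 in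
  let d := grady f z0.1 z0.2 + grady (f_ i) z.1 z.2 - grady (f_ i) z0.1 z0.2 in
  (z.1 - (eta1 / n%:R) *: h, z.2 + (eta2 / n%:R) *: d).

Definition vr_epoch (R : realType) (d n : nat)
    (f_ : 'I_n -> 'rV[R]_d -> 'rV[R]_d -> R) (eta1 eta2 : R)
    (pi : 'S_n) (z0 : 'rV[R]_d * 'rV[R]_d) : 'rV[R]_d * 'rV[R]_d :=
  foldl (fun z j => vr_step f_ eta1 eta2 z0 z (pi j)) z0 (enum 'I_n).

(* [pi t] is the permutation used in epoch [t]. *)
Fixpoint sgda_vr (R : realType) (d n : nat)
    (f_ : 'I_n -> 'rV[R]_d -> 'rV[R]_d -> R) (eta1 eta2 : R)
    (z0 : 'rV[R]_d * 'rV[R]_d) (pi : nat -> 'S_n) (t : nat) :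
    'rV[R]_d * 'rV[R]_d :=
  if t is t'.+1
  then vr_epoch f_ eta1 eta2 (pi t') (sgda_vr f_ eta1 eta2 z0 pi t')
  else z0.

Definition uniform_perm (R : realType) (disp : measure_display)
    (Omega : measurableType disp) (P : probability Omega R) (n : nat)
    (sigma : Omega -> 'S_n) : Prop :=
  forall s : 'S_n, measurable [set w | sigma w = s] /\
    P [set w | sigma w = s] = ((n`!)%:R^-1)%:E.

(* For finitely valued random variables, mutual independence amounts to the
   product rule on the atoms of every finite subfamily. *)
Definition independent_perms (R : realType) (disp : measure_display)
    (Omega : measurableType disp) (P : probability Omega R) (n : nat)
    (pi : nat -> Omega -> 'S_n) : Prop :=
  forall (I : seq nat) (s : nat -> 'S_n), uniq I ->
    P (\bigcap_(t in [set` I]) [set w | pi t w = s t]) =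
    (\prod_(t <- I) P [set w | pi t w = s t])%E.

(* Incremental gradient (with its fixed permutation), shuffling once, and
   random reshuffling. *)
Inductive shuffling (n : nat) : Type :=
  | IG of 'S_n
  | SO
  | RR.

Definition follows (R : realType) (disp : measure_display)
    (Omega : measurableType disp) (P : probability Omega R) (n : nat)
    (scheme : shuffling n) (pi : nat -> Omega -> 'S_n) : Prop :=
  match scheme with
  | IG s => forall t w, pi t w = s
  | SO => exists2 sigma : Omega -> 'S_n,
      uniform_perm P sigma & forall t w, pi t w = sigma w
  | RR => (forall t, uniform_perm P (pi t)) /\ independent_perms P pi
  end.

(* Main.v *)
Require Import Defs.
From HB Require Import structures.
From mathcomp Require Import all_boot all_order all_algebra all_fingroup.
From mathcomp Require Import all_classical all_reals all_analysis.
From mathcomp Require Import measurable_realfun ring lra.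

Set Implicit Arguments.
Unset Strict Implicit.
Unset Printing Implicit Defensive.

Import Order.TTheory GRing.Theory Num.Theory.
Import numFieldNormedType.Exports.

Local Open Scope classical_set_scope.
Local Open Scope ring_scope.

(** The potential [4 (Phi - inf Phi) + Phi - f] decreases by at least
    [eta1 |grad Phi x_t|^2] over each epoch, whatever permutation the epoch
    uses. It is nonnegative, so the sum of these decreases is at most its
    initial value along every path, and integrating this pathwise bound gives
    the bound on the expectations ([sum_sqr_grad_le], [measurable_iterates]).

    Three facts yield the decrease. Since each step corrects the full gradient
    at the start of the epoch by a difference of component gradients, an epoch
    is one step of gradient descent-ascent, with step sizes [eta1] and [eta2],
    up to an error of order [l (eta1 |gradx f| + eta2 |grady f|)] in each
    direction ([vr_epoch_drift]). The maximum function [Phi] satisfies a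
    descent lemma with constant [l (1 + kappa)] and its gradient at [x] is
    [gradx f x ys], where [ys] maximizes [f x] ([Phi_taylor], [grad_Phi]).
    Strong concavity gives [mu |y - ys| <= |grady f x y|]
    ([dist_max_le_norm_grad]), so that [gradx f] differs from [grad Phi] by at
    most [kappa |grady f|].

    To first order the descent step changes the potential by
    [- eta1 <5 grad Phi - gradx f, gradx f>], that is [- 4 eta1 |grad Phi|^2] up
    to terms in [kappa |grady f|], and the ascent step changes it by
    [- eta2 |grady f|^2]. As [eta2 = r eta1] and [r >= 14 kappa^2], the second
    contribution absorbs all terms in [kappa |grady f|]; the smallness of
    [l eta2] takes care of the epoch error and of the second-order terms
    ([potential_quadratic_form], [drift_decrease], [potential_decrease]). *)

(** * Euclidean inner product and norm *)

Section Euclidean.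
Variables (R : realType) (d : nat).
Implicit Types (u v w : 'rV[R]_d) (a : R).

Definition dot u v : R := \sum_(j < d) u 0 j * v 0 j.

Lemma dotC u v : dot u v = dot v u.
Proof. by apply: eq_bigr => j _; rewrite mulrC. Qed.

Lemma dotDl u v w : dot (u + v) w = dot u w + dot v w.
Proof. by rewrite -big_split; apply: eq_bigr => j _; rewrite mxE mulrDl. Qed.

Lemma dotZl a u v : dot (a *: u) v = a * dot u v.
Proof. by rewrite mulr_sumr; apply: eq_bigr => j _; rewrite mxE mulrA. Qed.

Lemma dotNl u v : dot (- u) v = - dot u v.
Proof. by rewrite -scaleN1r dotZl mulN1r. Qed.

Lemma dotBl u v w : dot (u - v) w = dot u w - dot v w.
Proof. by rewrite dotDl dotNl. Qed.

Lemma dotDr u v w : dot u (v + w) = dot u v + dot u w.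
Proof. by rewrite dotC dotDl !(dotC _ u). Qed.

Lemma dotZr a u v : dot u (a *: v) = a * dot u v.
Proof. by rewrite dotC dotZl dotC. Qed.

Lemma dotNr u v : dot u (- v) = - dot u v.
Proof. by rewrite dotC dotNl dotC. Qed.

Lemma dotBr u v w : dot u (v - w) = dot u v - dot u w.
Proof. by rewrite dotDr dotNr. Qed.

Lemma dot_delta u j : dot u (delta_mx 0 j) = u 0 j.
Proof.
rewrite /dot (bigD1 j) //= big1 => [|k kj]; rewrite !mxE eqxx /=.
  by rewrite eqxx mulr1 addr0.
by rewrite (negPf kj) mulr0.
Qed.

Lemma norm2_ge0 u : 0 <= norm2 u.
Proof. exact: sqrtr_ge0. Qed.

Lemma sqr_norm2 u : norm2 u ^+ 2 = dot u u.
Proof.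
rewrite sqr_sqrtr; last by apply: sumr_ge0 => j _; exact: sqr_ge0.
by apply: eq_bigr => j _; rewrite expr2.
Qed.

Lemma norm2_eq0 u : norm2 u = 0 -> u = 0.
Proof.
move=> u0; have := sqr_norm2 u; rewrite u0 expr0n /= => /esym/eqP.
rewrite psumr_eq0 => [/allP uj0|j _]; last by rewrite -expr2 sqr_ge0.
apply/rowP => j; rewrite mxE; apply/eqP.
by have := uj0 j (mem_index_enum _); rewrite mulf_eq0 orbb.
Qed.

Lemma norm2Z a u : norm2 (a *: u) = `|a| * norm2 u.
Proof.
apply/eqP; rewrite -(@eqrXn2 _ 2) ?mulr_ge0 ?norm2_ge0//.
by rewrite exprMn !sqr_norm2 dotZl dotZr real_normK ?num_real// mulrA.
Qed.

Lemma norm2N u : norm2 (- u) = norm2 u.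
Proof. by rewrite -scaleN1r norm2Z normrN1 mul1r. Qed.

Lemma norm2_0 : norm2 (0 : 'rV[R]_d) = 0.
Proof. by rewrite -(scale0r 0) norm2Z normr0 mul0r. Qed.

Lemma norm2_distC u v : norm2 (u - v) = norm2 (v - u).
Proof. by rewrite -opprB norm2N. Qed.

(** Cauchy-Schwarz, from the nonnegativity of the square of
    [|v|^2 u - <u, v> v]. *)
Lemma dot_le_norm2 u v : dot u v <= norm2 u * norm2 v.
Proof.
have [v0|vn0] := eqVneq (norm2 v) 0.
  by rewrite (norm2_eq0 v0) norm2_0 mulr0 -(scale0r 0) dotZr mul0r.
have nv : 0 < norm2 v by rewrite lt_def vn0 norm2_ge0.
apply: (le_trans (ler_norm _)).
rewrite -(@ler_pXn2r _ 2) ?nnegrE ?mulr_ge0 ?norm2_ge0//.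
rewrite real_normK ?num_real// exprMn -subr_ge0.
rewrite -(pmulr_rge0 _ (exprn_gt0 2 nv)).
rewrite (_ : _ * _ = norm2 (norm2 v ^+ 2 *: u - dot u v *: v) ^+ 2) ?sqr_ge0//.
rewrite !sqr_norm2 !(dotBl, dotBr, dotZl, dotZr) (dotC v u); ring.
Qed.

Lemma normr_dot_le u v : `|dot u v| <= norm2 u * norm2 v.
Proof.
by rewrite ler_norml dot_le_norm2 andbT lerNl -dotNl -(norm2N u) dot_le_norm2.
Qed.

Lemma norm2D u v : norm2 (u + v) <= norm2 u + norm2 v.
Proof.
rewrite -(@ler_pXn2r _ 2) ?nnegrE ?addr_ge0 ?norm2_ge0// sqrrD !sqr_norm2.
rewrite !(dotDl, dotDr) (dotC v u); have := dot_le_norm2 u v; lra.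
Qed.

Lemma norm2_le_sub u v : norm2 u <= norm2 (u - v) + norm2 v.
Proof. by have := norm2D (u - v) v; rewrite subrK. Qed.

Lemma norm2_sum (I : Type) (s : seq I) (F : I -> 'rV[R]_d) :
  norm2 (\sum_(i <- s) F i) <= \sum_(i <- s) norm2 (F i).
Proof.
elim/big_ind2 : _ => [|u x v y ux vy|//]; first by rewrite norm2_0.
exact: le_trans (norm2D _ _) (lerD ux vy).
Qed.

Lemma normr_coord_le u j : `|u 0 j| <= norm2 u.
Proof.
rewrite -(@ler_pXn2r _ 2) ?nnegrE ?norm2_ge0// real_normK ?num_real//.
rewrite sqr_norm2 /dot (bigD1 j)//= -expr2 lerDl.
by apply: sumr_ge0 => k _; rewrite -expr2 sqr_ge0.
Qed.

Lemma mx_norm_le_norm2 u : `|u| <= norm2 u.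
Proof.
rewrite /Num.norm /= mx_normrE; apply/bigmax_leP; split; first exact: norm2_ge0.
by move=> [i j] _ /=; rewrite (ord1 i) normr_coord_le.
Qed.

End Euclidean.

Lemma sqr_norm2_row_mx (R : realType) d (u v : 'rV[R]_d) :
  norm2 (row_mx u v) ^+ 2 = norm2 u ^+ 2 + norm2 v ^+ 2.
Proof.
rewrite !sqr_norm2 /dot big_split_ord /=; congr (_ + _); apply: eq_bigr => j _.
  by rewrite row_mxEl.
by rewrite row_mxEr.
Qed.

Lemma norm2_row_mxl (R : realType) d (u v : 'rV[R]_d) :
  norm2 u <= norm2 (row_mx u v).
Proof.
rewrite -(@ler_pXn2r _ 2) ?nnegrE ?norm2_ge0// sqr_norm2_row_mx.
by rewrite lerDl sqr_ge0.
Qed.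

Lemma norm2_row_mxr (R : realType) d (u v : 'rV[R]_d) :
  norm2 v <= norm2 (row_mx u v).
Proof.
rewrite -(@ler_pXn2r _ 2) ?nnegrE ?norm2_ge0// sqr_norm2_row_mx.
by rewrite lerDr sqr_ge0.
Qed.

(** * Taylor bounds for functions with Lipschitz gradient *)

Lemma taylor1_le (R : realType) (psi dpsi : R -> R) (K : R) :
  (forall t : R, is_derive t 1 psi (dpsi t)) ->
  (forall t : R, 0 <= t <= 1 -> dpsi t <= dpsi 0 + K * t) ->
  psi 1 <= psi 0 + dpsi 0 + K / 2.
Proof.
move=> psiE dpsiK.
pose g (t : R) := psi t - (dpsi 0 * t + K / 2 * t ^+ 2).
have gE (t : R) : is_derive t 1 g (dpsi t - (dpsi 0 + K * t)).
  have := psiE t => psit.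
  by rewrite /g; apply: is_derive_eq; rewrite /GRing.scale /=; field.
have gcont : {within `[0, 1], continuous g}.
  by apply: derivable_within_continuous => s _; case: (gE s).
have [c c01] := MVT ltr01 (fun t _ => gE t) gcont.
rewrite subr0 mulr1 /g => gc; move: c01; rewrite in_itv /= => /andP[c0 c1].
have : dpsi c <= dpsi 0 + K * c by apply: dpsiK; rewrite !ltW.
lra.
Qed.

Lemma taylor1 (R : realType) (psi dpsi : R -> R) (K : R) :
  (forall t : R, is_derive t 1 psi (dpsi t)) ->
  (forall t : R, 0 <= t <= 1 -> `|dpsi t - dpsi 0| <= K * t) ->
  `|psi 1 - psi 0 - dpsi 0| <= K / 2.
Proof.
move=> psiE dpsiK; rewrite ler_norml; apply/andP; split.
  have : - psi 1 <= - psi 0 + - dpsi 0 + K / 2; last by lra.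
  apply: (@taylor1_le _ (- psi) (fun t => - dpsi t)) => t /dpsiK.
  rewrite ler_norml => /andP[+ _]; lra.
have : psi 1 <= psi 0 + dpsi 0 + K / 2; last by lra.
apply: taylor1_le => // t /dpsiK; rewrite ler_norml => /andP[_]; lra.
Qed.

Section Gradient.
Variables (R : realType) (d : nat).
Implicit Types (phi : 'rV[R]_d -> R) (x u v : 'rV[R]_d).

Lemma derive_dot_grad phi x v : differentiable phi x ->
  'D_v phi x = dot (grad phi x) v.
Proof.
move=> dphi; rewrite deriveE// {1}(row_sum_delta v) linear_sum /=.
apply: eq_bigr => j _; rewrite linearZ /= -deriveE// /grad mxE.
by rewrite /GRing.scale /= mulrC.
Qed.

Lemma is_derive_line phi x u (t : R) : (forall x, differentiable phi x) ->
  is_derive t 1 (fun t => phi (x + t *: u)) (dot (grad phi (x + t *: u)) u).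
Proof.
move=> dphi.
have dline : differentiable (fun t : R => x + t *: u) t by [].
split; first by apply: diff_derivable; apply: differentiable_comp.
rewrite deriveE; last by apply: differentiable_comp.
rewrite (@diff_comp _ _ _ _ (fun t : R => x + t *: u) phi)//=.
rewrite -derive_dot_grad//.
rewrite deriveE//; congr ('d _ _ _).
by rewrite diff_val /= add0r scale1r.
Qed.

(** Two-sided descent lemma. *)
Lemma lipschitz_grad_taylor phi x u (l : R) :
    (forall x, differentiable phi x) ->
    (forall x v, norm2 (grad phi v - grad phi x) <= l * norm2 (v - x)) ->
  `|phi (x + u) - phi x - dot (grad phi x) u| <= l / 2 * norm2 u ^+ 2.
Proof.
move=> dphi lip.
pose dpsi (t : R) := dot (grad phi (x + t *: u)) u.
have := @taylor1 _ _ dpsi (l * norm2 u ^+ 2)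
  (fun t => is_derive_line x u t dphi).
rewrite /dpsi scale1r scale0r addr0 (mulrAC l); apply => t /andP[t0 _].
rewrite -dotBl (le_trans (normr_dot_le _ _))//.
have := lip x (x + t *: u).
rewrite addrAC subrr add0r norm2Z ger0_norm// => lipt.
have := norm2_ge0 u; nra.
Qed.

(** [Phi] is only known as a supremum; its gradient will be read off such a
    bound. *)
Lemma quadratic_error_grad phi x g (C : R) :
    (forall u, `|phi (x + u) - phi x - dot g u| <= C * norm2 u ^+ 2) ->
  grad phi x = g.
Proof.
move=> err; apply/rowP => j; rewrite mxE.
set v := delta_mx 0 j; rewrite -(dot_delta g j) -/v.
apply/cvg_lim => //; apply/cvgrPdist_le => e e0.
pose K := `|C| * norm2 v ^+ 2 + 1.
have K0 : 0 < K by apply: ltr_wpDl => //; apply: mulr_ge0 => //; exact: sqr_ge0.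
near=> h.
have h0 : h != 0 by near: h; exact: nbhs_dnbhs_neq.
have hK : `|h| <= e / K.
  near: h; apply: dnbhs0_le; exact: divr_gt0.
rewrite /= distrC /GRing.scale /=.
have -> : h^-1 * (phi (h *: v + x) - phi x) - dot g v =
   h^-1 * (phi (x + h *: v) - phi x - dot g (h *: v)).
  by rewrite dotZr (addrC x); field.
rewrite normrM normfV ler_pdivrMl ?normr_gt0//.
apply: (le_trans (err _)); rewrite norm2Z exprMn mulrCA expr2 -mulrA.
apply: ler_wpM2l => //; apply: (@le_trans _ _ (`|h| * K)).
  apply: ler_wpM2l => //; rewrite /K.
  have : C * norm2 v ^+ 2 <= `|C| * norm2 v ^+ 2.
    by rewrite ler_wpM2r ?sqr_ge0 ?ler_norm.
  lra.
by rewrite -ler_pdivlMr.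
Unshelve. all: by end_near.
Qed.

End Gradient.

(** * Strongly concave functions *)

(** Replaces a passage to the limit [s -> 0] along a chord. *)
Lemma le_of_small_error (R : realType) (a b c : R) :
  (forall s, 0 < s <= 1 -> a <= b + s * c) -> a <= b.
Proof.
move=> small; rewrite leNgt; apply/negP => ba.
pose s := Num.min 1 ((a - b) / (2 * (`|c| + 1))).
have c1 : 0 < `|c| + 1 by rewrite ltr_wpDl.
have s0 : 0 < s.
  by rewrite lt_min ltr01 divr_gt0 ?subr_gt0 ?mulr_gt0.
have /small : 0 < s <= 1 by rewrite s0 ge_min lexx.
have : s * c <= s * (`|c| + 1).
  by rewrite ler_wpM2l ?(ltW s0)// (le_trans (ler_norm c))// lerDl.
have : s <= (a - b) / (2 * (`|c| + 1)) by rewrite ge_min lexx orbT.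
rewrite ler_pdivlMr ?mulr_gt0//; lra.
Qed.

Section StronglyConcave.
Variables (R : realType) (d : nat) (mu l : R) (g : 'rV[R]_d -> R).
Hypotheses (mu0 : 0 < mu) (gconc : strongly_concave mu g).
Hypothesis dg : forall y, differentiable g y.
Hypothesis glip :
  forall y v, norm2 (grad g v - grad g y) <= l * norm2 (v - y).

(** The chord inequality between [y] and [y + s (v - y)], divided by [s]; the
    descent lemma controls the chord slope up to [O(s)]. *)
Lemma strongly_concave_le_tangent y v :
  g v <= g y + dot (grad g y) (v - y) - mu / 2 * norm2 (v - y) ^+ 2.
Proof.
set N := norm2 _ ^+ 2.
apply: (@le_of_small_error _ _ _ ((l + mu) / 2 * N)) => s /andP[s0 s1].
have := gconc v y (_ : 0 <= s <= 1); rewrite (ltW s0) s1 => /(_ isT).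
have -> : s *: v + (1 - s) *: y = y + s *: (v - y).
  by rewrite scalerBl scalerBr scale1r addrCA.
have := lipschitz_grad_taylor y (s *: (v - y)) dg glip.
rewrite ler_norml => /andP[_]; rewrite dotZr norm2Z exprMn -/N.
rewrite (gtr0_norm s0) => up lo.
rewrite -(ler_pM2l s0); lra.
Qed.

Lemma strongly_concave_le_max ys v : (forall y, g y <= g ys) ->
  g v <= g ys - mu / 2 * norm2 (v - ys) ^+ 2.
Proof.
move=> ysmax; set N := norm2 _ ^+ 2.
apply: (@le_of_small_error _ _ _ (mu / 2 * N)) => s /andP[s0 s1].
have := gconc v ys (_ : 0 <= s <= 1); rewrite (ltW s0) s1 => /(_ isT).
have := ysmax (s *: v + (1 - s) *: ys); rewrite -/N => up lo.
rewrite -(ler_pM2l s0); lra.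
Qed.

(** The tangent bound at [y] and the bound at the maximizer add up to
    [mu |y - ys|^2 <= <grad g y, ys - y>]. *)
Lemma dist_max_le_norm_grad ys y : (forall y, g y <= g ys) ->
  mu * norm2 (y - ys) <= norm2 (grad g y).
Proof.
move=> ysmax; have := strongly_concave_le_max y ysmax.
have := strongly_concave_le_tangent y ys; rewrite norm2_distC.
have := dot_le_norm2 (grad g y) (ys - y); rewrite (norm2_distC ys).
have := norm2_ge0 (y - ys); have := norm2_ge0 (grad g y).
set N := norm2 (y - ys); set b := norm2 _; set t := dot _ _ => b0 N0 CS h1 h2.
have [->|Nn0] := eqVneq N 0; first by rewrite mulr0.
have Np : 0 < N by rewrite lt_def Nn0.
rewrite -(ler_pM2r Np); lra.
Qed.

(** Outside a ball whose radius is read off the gradient at the origin, the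
    quadratic upper bound keeps [g] below its value at the origin. *)
Lemma strongly_concave_max_exists : exists ys, forall y, g y <= g ys.
Proof.
pose b := norm2 (grad g 0); pose M := 2 * b / mu.
pose A : set 'rV[R]_d := [set y | `|y| <= M].
have M0 : 0 <= M by rewrite divr_ge0 ?mulr_ge0 ?norm2_ge0 ?ltW.
have A0 : A 0 by rewrite /A /= normr0.
have cA : compact A.
  apply: bounded_closed_compact.
    exists M; split => [|x Mx y /le_trans]; first exact: num_real.
    by apply; exact: ltW.
  apply: (@closed_comp _ _ (fun y : 'rV[R]_d => `|y|) [set r : R | r <= M]).
    by move=> y _; exact: norm_continuous.
  exact: closed_le.
have cg : {within A, continuous g}.
  by apply: continuous_subspaceT => y; exact: differentiable_continuous.
have [|ys _ ysmax] := EVT_max_rV _ cA cg; first by exists 0.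
exists ys => y; have [yA|/negP yA] := boolP (y \in A); first exact: ysmax.
apply: (le_trans _ (ysmax 0 _)); last by rewrite inE.
have yM : M < `|y| by rewrite ltNge; apply/negP => yM; apply: yA; rewrite inE.
have := strongly_concave_le_tangent 0 y; rewrite subr0.
have := dot_le_norm2 (grad g 0) y; rewrite -/b.
have := lt_le_trans yM (mx_norm_le_norm2 y).
rewrite ltr_pdivrMr//; set N := norm2 y => NM CS le.
have N0 : 0 <= N by exact: norm2_ge0.
have : 2 * b * N <= N * mu * N by rewrite ler_wpM2r// ltW.
lra.
Qed.

End StronglyConcave.

(** * Smooth functions, averages and the maximum function *)

Section Smooth.
Variables (R : realType) (d : nat) (l : R) (f : 'rV[R]_d -> 'rV[R]_d -> R).
Hypothesis fsmooth : smooth l f.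

Lemma smooth_differentiable_x x y : differentiable (fun x => f x y) x.
Proof.
have dxy : differentiable (fun x : 'rV[R]_d => (x, y)) x.
  exact: differentiable_pair.
exact: (differentiable_comp dxy (fsmooth.1 (x, y))).
Qed.

Lemma smooth_differentiable_y x y : differentiable (f x) y.
Proof.
have dxy : differentiable (fun y : 'rV[R]_d => (x, y)) y.
  exact: differentiable_pair.
exact: (differentiable_comp dxy (fsmooth.1 (x, y))).
Qed.

Lemma smooth_gradx x1 y1 x2 y2 :
  norm2 (gradx f x1 y1 - gradx f x2 y2)
  <= l * (norm2 (x1 - x2) + norm2 (y1 - y2)).
Proof.
apply: le_trans (fsmooth.2 x1 y1 x2 y2).
by rewrite opp_row_mx add_row_mx norm2_row_mxl.
Qed.

Lemma smooth_grady x1 y1 x2 y2 :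
  norm2 (grady f x1 y1 - grady f x2 y2)
  <= l * (norm2 (x1 - x2) + norm2 (y1 - y2)).
Proof.
apply: le_trans (fsmooth.2 x1 y1 x2 y2).
by rewrite opp_row_mx add_row_mx norm2_row_mxr.
Qed.

Lemma smooth_taylor_x x y u :
  `|f (x + u) y - f x y - dot (gradx f x y) u| <= l / 2 * norm2 u ^+ 2.
Proof.
apply: (lipschitz_grad_taylor (phi := fun x => f x y)) => [z|z v].
  exact: smooth_differentiable_x.
by have := smooth_gradx v y z y; rewrite subrr norm2_0 addr0.
Qed.

Lemma smooth_lip_grady x y v :
  norm2 (grad (f x) v - grad (f x) y) <= l * norm2 (v - y).
Proof. by have := smooth_grady x v x y; rewrite subrr norm2_0 add0r. Qed.

Lemma smooth_taylor_y x y u :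
  `|f x (y + u) - f x y - dot (grady f x y) u| <= l / 2 * norm2 u ^+ 2.
Proof.
apply: lipschitz_grad_taylor => [z|z v]; last exact: smooth_lip_grady.
exact: smooth_differentiable_y.
Qed.

(** Move [x] first and [y] second; the cross term [l |u| |v|] pays for the
    change of the [y]-gradient caused by the first move. *)
Lemma smooth_lower_bound x y u v :
  f x y + dot (gradx f x y) u + dot (grady f x y) v
    - l / 2 * (norm2 u + norm2 v) ^+ 2 <= f (x + u) (y + v).
Proof.
have := smooth_taylor_x x y u; rewrite ler_norml => /andP[fx _].
have := smooth_taylor_y (x + u) y v; rewrite ler_norml => /andP[fy _].
have := smooth_grady (x + u) y x y.
rewrite subrr norm2_0 addr0 addrAC subrr add0r => gy.
have := dot_le_norm2 (grady f x y - grady f (x + u) y) v.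
rewrite dotBl norm2_distC => CS.
have := ler_wpM2r (norm2_ge0 v) gy; lra.
Qed.

End Smooth.

Section Average.
Variables (R : realType) (d n : nat) (f_ : 'I_n -> 'rV[R]_d -> 'rV[R]_d -> R).

Lemma grad_avg (phi_ : 'I_n -> 'rV[R]_d -> R) x :
  (forall i, differentiable (phi_ i) x) ->
  grad (fun x => n%:R^-1 * \sum_(i < n) phi_ i x) x =
  n%:R^-1 *: \sum_(i < n) grad (phi_ i) x.
Proof.
move=> dphi; apply/rowP => j; rewrite !mxE summxE.
have -> : (fun x => n%:R^-1 * \sum_(i < n) phi_ i x) =
    n%:R^-1 \*: (\sum_(i < n) phi_ i).
  by apply/funext => z; rewrite /= fct_sumE.
have der i : derivable (phi_ i) x (delta_mx 0 j) by exact: diff_derivable.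
rewrite deriveZ; last exact: derivable_sum.
by rewrite derive_sum//; congr (_ * _); apply: eq_bigr => i _; rewrite mxE.
Qed.

Hypothesis (n0 : (0 < n)%N).

Lemma smooth_avg l : (forall i, smooth l (f_ i)) -> smooth l (avg f_).
Proof.
move=> sm; split=> [p|x1 y1 x2 y2].
  rewrite (_ : (fun _ => _) =
    n%:R^-1 *: (\sum_(i < n) (fun q : 'rV[R]_d * 'rV[R]_d => f_ i q.1 q.2))).
    by apply: differentiableZ; apply: differentiable_sum => i; exact: (sm i).1.
  by apply/funext => q; rewrite /avg /GRing.scale /= fct_sumE.
have gxE x y : gradx (avg f_) x y = n%:R^-1 *: \sum_(i < n) gradx (f_ i) x y.
  by rewrite /gradx grad_avg// => i; exact: smooth_differentiable_x (sm i) _ _.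
have gyE x y : grady (avg f_) x y = n%:R^-1 *: \sum_(i < n) grady (f_ i) x y.
  by rewrite /grady grad_avg// => i; exact: smooth_differentiable_y (sm i) _ _.
rewrite !gxE !gyE opp_row_mx add_row_mx -!scalerBr -scale_row_mx -!sumrB.
rewrite (_ : row_mx _ _ = \sum_(i < n)
  (row_mx (gradx (f_ i) x1 y1) (grady (f_ i) x1 y1) -
   row_mx (gradx (f_ i) x2 y2) (grady (f_ i) x2 y2))); last first.
  apply/rowP => j; rewrite summxE -(splitK j); case: (fintype.split j) => k /=.
    rewrite row_mxEl summxE; apply: eq_bigr => i _.
    by rewrite opp_row_mx add_row_mx row_mxEl.
  rewrite row_mxEr summxE; apply: eq_bigr => i _.
  by rewrite opp_row_mx add_row_mx row_mxEr.
rewrite norm2Z ger0_norm ?invr_ge0// ler_pdivrMl ?ltr0n//.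
apply: (le_trans (norm2_sum _ _)).
rewrite -[n in leRHS]card_ord -sum1_card natr_sum mulr_suml ler_sum// => i _.
by rewrite mul1r; exact: (sm i).2.
Qed.

End Average.

Section Danskin.
Variables (R : realType) (d : nat) (l mu : R).
Variable f : 'rV[R]_d -> 'rV[R]_d -> R.
Hypotheses (fsmooth : smooth l f) (mu0 : 0 < mu).
Hypothesis fconc : forall x, strongly_concave mu (f x).

Lemma PhiE x ys : (forall y, f x y <= f x ys) -> Phi f x = f x ys.
Proof.
move=> ysmax; apply/eqP; rewrite eq_le; apply/andP; split.
  by apply: ge_sup => [|_ [y _ <-]//]; exists (f x ys), ys.
by apply: ub_le_sup; [exists (f x ys) => _ [y _ <-]|exists ys].
Qed.

Lemma argmax_exists x : exists ys, forall y, f x y <= f x ys.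
Proof.
apply: (strongly_concave_max_exists (l := l) mu0 (fconc x)).
  exact: smooth_differentiable_y fsmooth x.
exact: smooth_lip_grady.
Qed.

Lemma le_Phi x y : f x y <= Phi f x.
Proof. by have [ys ysmax] := argmax_exists x; rewrite (PhiE ysmax). Qed.

(** Below, freeze [y] at the maximizer [ys]. Above, let [yu] be the maximizer at
    [x + u]: replacing [gradx f x yu] by [gradx f x ys] costs [l |yu - ys| |u|],
    but by strong concavity [f x yu] is below [Phi f x] by at least
    [mu / 2 |yu - ys|^2], which leaves at most [l^2 / (2 mu) |u|^2]. *)
Lemma Phi_taylor x ys u : (forall y, f x y <= f x ys) ->
  - (l / 2) * norm2 u ^+ 2
    <= Phi f (x + u) - Phi f x - dot (gradx f x ys) u
    <= l / 2 * (1 + l / mu) * norm2 u ^+ 2.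
Proof.
move=> ysmax; apply/andP; split.
  have := smooth_taylor_x fsmooth x ys u; rewrite ler_norml => /andP[lo _].
  have := le_Phi (x + u) ys; rewrite (PhiE ysmax); lra.
have [yu yumax] := argmax_exists (x + u).
have := smooth_taylor_x fsmooth x yu u; rewrite ler_norml => /andP[_ up].
rewrite (PhiE yumax) (PhiE ysmax).
have := strongly_concave_le_max (fconc x) yu ysmax.
have := smooth_gradx fsmooth x yu x ys; rewrite subrr norm2_0 add0r => lip.
have := dot_le_norm2 (gradx f x yu - gradx f x ys) u; rewrite dotBl => CS.
have := ler_wpM2r (norm2_ge0 u) lip.
set D := norm2 (yu - ys); set U := norm2 u in up CS * => lipU conc.
(* the square completed here is mu D - l U *)
have : l * D * U <= mu / 2 * D ^+ 2 + l / 2 * (l / mu) * U ^+ 2.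
  rewrite -subr_ge0 (_ : _ - _ = (mu * D - l * U) ^+ 2 / (2 * mu)).
    by rewrite divr_ge0 ?sqr_ge0// mulr_ge0// ltW.
  by field; rewrite gt_eqF.
lra.
Qed.

Lemma grad_Phi x ys : 0 <= l -> (forall y, f x y <= f x ys) ->
  grad (Phi f) x = gradx f x ys.
Proof.
move=> l0 ysmax.
apply: (@quadratic_error_grad _ _ _ _ _ (l / 2 * (1 + l / mu))) => u.
have /andP[lo up] := Phi_taylor u ysmax.
have : 0 <= l / 2 * (l / mu) * norm2 u ^+ 2.
  apply: mulr_ge0; last exact: sqr_ge0.
  by apply: mulr_ge0; apply: divr_ge0 => //; exact: ltW.
rewrite ler_norml; lra.
Qed.

End Danskin.

(** * One epoch as a perturbed gradient step *)

Section Epoch.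
Variables (R : realType) (d n : nat) (l eta1 eta2 : R).
Variable f_ : 'I_n -> 'rV[R]_d -> 'rV[R]_d -> R.
Hypotheses (n0 : (0 < n)%N) (l0 : 0 <= l) (fsmooth : forall i, smooth l (f_ i)).
Hypotheses (eta1_ge0 : 0 <= eta1) (eta2_ge0 : 0 <= eta2).
Hypothesis eta_small : l * (eta1 + eta2) <= 1 / 6.
Variable z0 : 'rV[R]_d * 'rV[R]_d.

Variables gx gy : 'rV[R]_d.
Hypothesis gxE : gradx (avg f_) z0.1 z0.2 = gx.
Hypothesis gyE : grady (avg f_) z0.1 z0.2 = gy.

Definition epoch_error : R :=
  6 / 5 * l * (eta1 * norm2 gx + eta2 * norm2 gy).

Lemma epoch_error_ge0 : 0 <= epoch_error.
Proof.
by rewrite /epoch_error !mulr_ge0// addr_ge0// mulr_ge0// norm2_ge0.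
Qed.

(** The variance-reduced direction differs from the full gradient at [z0] by a
    difference of component gradients, hence by at most [l] times the distance
    of the current iterate from [z0]. The constant 6/5 in [epoch_error] makes
    the bound self-reproducing: as long as it holds, the iterates stay within
    [6/5 * (eta1 |gx| + eta2 |gy|)] of [z0], because
    [1 + l (eta1 + eta2) * 6/5 <= 6/5]. *)
Lemma vr_steps_drift (s : seq 'I_n) : (size s <= n)%N ->
  let z := foldl (vr_step f_ eta1 eta2 z0) z0 s in
  let c := (size s)%:R / n%:R in
  norm2 (z.1 - z0.1 + (c * eta1) *: gx) <= c * eta1 * epoch_error /\
  norm2 (z.2 - z0.2 - (c * eta2) *: gy) <= c * eta2 * epoch_error.
Proof.
have nR0 : 0 < n%:R :> R by rewrite ltr0n.
elim/last_ind: s => [_ /=|s i IH].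
  by rewrite !mul0r !scale0r !subrr addr0 norm2_0.
rewrite size_rcons => sn; have {IH} := IH (ltnW sn).
rewrite /= foldl_rcons; move: (foldl _ _ _) => z; set c := _ / _.
have -> : (size s).+1%:R / n%:R = c + n%:R^-1 by rewrite -natr1 mulrDl mul1r.
move=> [dx dy].
have c0 : 0 <= c by rewrite divr_ge0.
have c1 : c <= 1 by rewrite ler_pdivrMr// mul1r ler_nat ltnW.
have e0 := epoch_error_ge0.
have nx : norm2 (z.1 - z0.1) <= eta1 * (norm2 gx + epoch_error).
  have := norm2_le_sub (z.1 - z0.1) (- ((c * eta1) *: gx)); rewrite opprK.
  have : norm2 (- ((c * eta1) *: gx)) = c * eta1 * norm2 gx.
    by rewrite norm2N norm2Z ger0_norm// mulr_ge0.
  have : c * eta1 * (norm2 gx + epoch_error) <= eta1 * (norm2 gx + epoch_error).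
    by rewrite ler_wpM2r ?addr_ge0 ?norm2_ge0// ler_piMl.
  lra.
have ny : norm2 (z.2 - z0.2) <= eta2 * (norm2 gy + epoch_error).
  have := norm2_le_sub (z.2 - z0.2) ((c * eta2) *: gy).
  have : norm2 ((c * eta2) *: gy) = c * eta2 * norm2 gy.
    by rewrite norm2Z ger0_norm// mulr_ge0.
  have : c * eta2 * (norm2 gy + epoch_error) <= eta2 * (norm2 gy + epoch_error).
    by rewrite ler_wpM2r ?addr_ge0 ?norm2_ge0// ler_piMl.
  lra.
have le_error : l * (norm2 (z.1 - z0.1) + norm2 (z.2 - z0.2)) <= epoch_error.
  have := ler_wpM2l l0 (lerD nx ny); have := ler_wpM2r e0 eta_small.
  rewrite {3}/epoch_error /epoch_error; lra.
have := smooth_grady (fsmooth i) z.1 z.2 z0.1 z0.2.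
have := smooth_gradx (fsmooth i) z.1 z.2 z0.1 z0.2.
rewrite /vr_step /= gxE gyE; set hx := gradx _ _ _; set hx0 := gradx _ _ _.
set hy := grady _ _ _; set hy0 := grady _ _ _ => hxe hye; split.
- have -> : z.1 - (eta1 / n%:R) *: (gx + hx - hx0) - z0.1
      + ((c + n%:R^-1) * eta1) *: gx =
    (z.1 - z0.1 + (c * eta1) *: gx) - (eta1 / n%:R) *: (hx - hx0).
    by apply/rowP => j; rewrite !mxE; ring.
  rewrite !mulrDl; apply: (le_trans (norm2D _ _) (lerD dx _)).
  rewrite norm2N norm2Z ger0_norm ?divr_ge0//.
  rewrite (mulrC _ eta1) ler_wpM2l ?divr_ge0//; exact: le_trans hxe le_error.
- have -> : z.2 + (eta2 / n%:R) *: (gy + hy - hy0) - z0.2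
      - ((c + n%:R^-1) * eta2) *: gy =
    (z.2 - z0.2 - (c * eta2) *: gy) + (eta2 / n%:R) *: (hy - hy0).
    by apply/rowP => j; rewrite !mxE; ring.
  rewrite !mulrDl; apply: (le_trans (norm2D _ _) (lerD dy _)).
  rewrite norm2Z ger0_norm ?divr_ge0//.
  rewrite (mulrC _ eta2) ler_wpM2l ?divr_ge0//; exact: le_trans hye le_error.
Qed.

(** After [n] steps of size [eta / n] the epoch amounts to one full gradient
    step of size [eta]. *)
Lemma vr_epoch_drift (pi : 'S_n) :
  let z := vr_epoch f_ eta1 eta2 pi z0 in
  norm2 (z.1 - z0.1 + eta1 *: gx) <= eta1 * epoch_error /\
  norm2 (z.2 - z0.2 - eta2 *: gy) <= eta2 * epoch_error.
Proof.
have -> : vr_epoch f_ eta1 eta2 pi z0 =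
    foldl (vr_step f_ eta1 eta2 z0) z0 (map pi (enum 'I_n)).
  by rewrite /vr_epoch; elim: (enum _) {2 4}z0 => //= j s IH z.
have := @vr_steps_drift (map pi (enum 'I_n)).
rewrite size_map size_enum_ord leqnn => /(_ isT) /=.
by rewrite divff ?pnatr_eq0 -?lt0n// !mul1r.
Qed.

End Epoch.

(** * Decrease of the potential *)

(** The quadratic form left once every vector has been replaced by its norm:
    [G], [a], [b] stand for the norms of the gradient of Phi and of the two
    partial gradients of f, [k] for kappa b, [e] for the error of the epoch. The
    negative term [- r b^2], worth at least [14 k^2], absorbs everything that is
    not a multiple of [G^2]: what is left is dominated by a definite quadratic
    form in [G] and [k]. *)
Lemma potential_quadratic_form (R : realType) (G k a b e r c1 c2 : R) :
    0 <= G -> 0 <= b <= k -> 0 <= a <= G + k -> 14 <= r ->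
    14 * k ^+ 2 <= r * b ^+ 2 -> 0 <= e -> r * e <= 3 / 20 * (a + r * b) ->
    c1 <= 1 / 56 -> c2 * r <= 1 / 8 -> 0 <= c2 ->
  - (4 * G ^+ 2) + 3 * (G * k) + k ^+ 2 + (4 * G + k) * e - r * b ^+ 2
    + r * (b * e) + 5 / 2 * c1 * (a + e) ^+ 2
    + c2 / 2 * (a + e + r * (b + e)) ^+ 2 <= - G ^+ 2.
Proof.
move=> G0 /andP[b0 bk] /andP[a0 aGk] r14 kb e0 re c1s c2s c20.
have r0 : 0 < r by lra.
have eab : e <= 3 / 280 * a + 3 / 20 * b.
  rewrite -(ler_pM2l r0); have : 14 * a <= r * a by rewrite ler_wpM2r.
  lra.
have eGk : e <= 3 / 280 * G + 45 / 280 * k by lra.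
have ebe : r * (b * e) <= 3 / 20 * (a * b + r * b ^+ 2).
  have := ler_wpM2l b0 re; lra.
have abk : a * b <= (G + k) * k by apply: ler_pM.
have k0 : 0 <= k by lra.
have t1 : c1 * (a + e) ^+ 2 <= 1 / 56 * (283 / 280 * G + 325 / 280 * k) ^+ 2.
  apply: (@le_trans _ _ (1 / 56 * (a + e) ^+ 2)).
    exact: (ler_wpM2r (sqr_ge0 (a + e)) c1s).
  have ae0 : 0 <= a + e by rewrite addr_ge0.
  have aeGk : a + e <= 283 / 280 * G + 325 / 280 * k by lra.
  apply: ler_wpM2l; first by lra.
  apply: (lerXn2r 2 _ _ aeGk); rewrite nnegrE; first exact: ae0.
  exact: le_trans ae0 aeGk.
have t2 : c2 * (a + e + r * (b + e)) ^+ 2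
    <= 27 / 160 * (a ^+ 2 / 14 + 2 * (a * b) + r * b ^+ 2).
  have s : (a + e + r * (b + e)) ^+ 2 <= 27 / 20 * (a + r * b) ^+ 2.
    apply: (@le_trans _ _ ((1161 / 1000 * (a + r * b)) ^+ 2)).
      have : 0 <= r * b by rewrite mulr_ge0// ltW.
      have : 14 * b <= r * b by rewrite ler_wpM2r.
      have : 0 <= r * e by rewrite mulr_ge0// ltW.
      move=> re0 rb14 rb0; have ab0 : 0 <= a + r * b by rewrite addr_ge0.
      have le : a + e + r * (b + e) <= 1161 / 1000 * (a + r * b) by lra.
      have ge : 0 <= a + e + r * (b + e) by rewrite !(addr_ge0, mulr_ge0)// ltW.
      apply: (lerXn2r 2 _ _ le); rewrite nnegrE; first exact: ge.
      exact: le_trans ge le.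
    have := sqr_ge0 (a + r * b); lra.
  apply: (le_trans (ler_wpM2l c20 s)).
  rewrite -(ler_pM2l r0).
  have := ler_wpM2r (sqr_ge0 (a + r * b)) c2s.
  have : 14 * a ^+ 2 <= r * a ^+ 2 by rewrite ler_wpM2r ?sqr_ge0.
  lra.
have t3 : (4 * G + k) * e <= (4 * G + k) * (3 / 280 * G + 45 / 280 * k).
  by apply: ler_wpM2l eGk; lra.
have a2 : a ^+ 2 <= (G + k) ^+ 2 by rewrite lerXn2r ?nnegrE ?addr_ge0.
have := mulr_ge0 G0 k0; have := sqr_ge0 (G - k).
have := sqr_ge0 G; have := sqr_ge0 k; lra.
Qed.

(** With the weight 4 the potential is [5 Phi - f] up to a constant. Its change
    along a step [(u, v)] close to [(- eta1 gx, eta1 r gy)], with [g] the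
    gradient of [Phi]; the left-hand side is the bound given by the two Taylor
    estimates. Writing [gx = g + dl] with [|dl| <= k], the [x]-part contributes
    [- eta1 <4 g - dl, g + dl>] to first order, hence [- 4 eta1 |g|^2] up to
    terms in [k]. *)
Lemma drift_decrease (R : realType) d (g gx gy u v : 'rV[R]_d)
    (eta1 r k e l L : R) :
    0 <= eta1 -> 0 <= l -> 0 <= L -> 14 <= r -> 0 <= e ->
    norm2 (gx - g) <= k -> norm2 gy <= k ->
    14 * k ^+ 2 <= r * norm2 gy ^+ 2 ->
    r * e <= 3 / 20 * (norm2 gx + r * norm2 gy) ->
    L * eta1 <= 1 / 56 -> l * eta1 * r <= 1 / 8 ->
    norm2 (u + eta1 *: gx) <= eta1 * e ->
    norm2 (v - (eta1 * r) *: gy) <= eta1 * r * e ->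
  5 * (dot g u + L / 2 * norm2 u ^+ 2)
    - (dot gx u + dot gy v - l / 2 * (norm2 u + norm2 v) ^+ 2)
  <= - (eta1 * norm2 g ^+ 2).
Proof.
move=> eta0 l0 L0 r14 e0 gxk gyk kb re Leta leta uE vE.
have r0 : 0 <= r by lra.
have k0 : 0 <= k := le_trans (norm2_ge0 _) gyk.
have aGk : norm2 gx <= norm2 g + k.
  by have := norm2_le_sub gx g; lra.
have U : norm2 u <= eta1 * (norm2 gx + e).
  have := norm2_le_sub u (- (eta1 *: gx)); rewrite opprK.
  have : norm2 (- (eta1 *: gx)) = eta1 * norm2 gx.
    by rewrite norm2N norm2Z ger0_norm.
  lra.
have V : norm2 v <= eta1 * r * (norm2 gy + e).
  have := norm2_le_sub v ((eta1 * r) *: gy).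
  have : norm2 ((eta1 * r) *: gy) = eta1 * r * norm2 gy.
    by rewrite norm2Z ger0_norm// mulr_ge0.
  lra.
have dotx : 5 * dot g u - dot gx u <= eta1 *
    (- (4 * norm2 g ^+ 2) + 3 * (norm2 g * k) + k ^+ 2 + (4 * norm2 g + k) * e).
  have [dl gxE dlk] : exists2 dl, gx = g + dl & norm2 dl <= k.
    by exists (gx - g) => //; rewrite addrC subrK.
  have [ex uE' exe] : exists2 ex, u = ex - eta1 *: gx & norm2 ex <= eta1 * e.
    by exists (u + eta1 *: gx) => //; rewrite addrK.
  have -> : 5 * dot g u - dot gx u = dot (4 *: g - dl) ex
      - eta1 * (4 * norm2 g ^+ 2 + 3 * dot g dl - norm2 dl ^+ 2).
    rewrite uE' gxE !sqr_norm2 !(dotDl, dotDr, dotNl, dotNr, dotZl, dotZr).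
    by rewrite (dotC dl g); ring.
  have n4 : norm2 (4 *: g - dl) <= 4 * norm2 g + k.
    apply: (le_trans (norm2D _ _)).
    by rewrite norm2N norm2Z ger0_norm// lerD2l.
  have := dot_le_norm2 (4 *: g - dl) ex.
  have := ler_pM (norm2_ge0 _) (norm2_ge0 _) n4 exe.
  have dk2 : norm2 dl ^+ 2 <= k ^+ 2 by rewrite ler_pXn2r ?nnegrE ?norm2_ge0.
  have gdk : - (norm2 g * k) <= dot g dl.
    have := normr_dot_le g dl; rewrite ler_norml => /andP[+ _].
    have := ler_wpM2l (norm2_ge0 g) dlk; lra.
  have : eta1 * (4 * norm2 g ^+ 2 - 3 * (norm2 g * k) - k ^+ 2) <=
      eta1 * (4 * norm2 g ^+ 2 + 3 * dot g dl - norm2 dl ^+ 2).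
    by rewrite ler_wpM2l//; lra.
  lra.
have doty : eta1 * (r * norm2 gy ^+ 2 - r * (norm2 gy * e)) <= dot gy v.
  have [ey vE' eye] :
      exists2 ey, v = ey + (eta1 * r) *: gy & norm2 ey <= eta1 * r * e.
    by exists (v - (eta1 * r) *: gy) => //; rewrite subrK.
  have -> : dot gy v = dot gy ey + eta1 * r * norm2 gy ^+ 2.
    by rewrite vE' dotDr dotZr sqr_norm2.
  have := normr_dot_le gy ey; rewrite ler_norml => /andP[+ _].
  have := ler_wpM2l (norm2_ge0 gy) eye; lra.
have U2 : L * norm2 u ^+ 2 <= eta1 * (L * eta1 * (norm2 gx + e) ^+ 2).
  have -> : eta1 * (L * eta1 * (norm2 gx + e) ^+ 2) =
      L * (eta1 * (norm2 gx + e)) ^+ 2 by ring.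
  rewrite ler_wpM2l// ler_pXn2r ?nnegrE ?norm2_ge0//.
  exact: le_trans (norm2_ge0 _) U.
have UV2 : l * (norm2 u + norm2 v) ^+ 2 <=
    eta1 * (l * eta1 * (norm2 gx + e + r * (norm2 gy + e)) ^+ 2).
  have -> : eta1 * (l * eta1 * (norm2 gx + e + r * (norm2 gy + e)) ^+ 2) =
    l * (eta1 * (norm2 gx + e) + eta1 * r * (norm2 gy + e)) ^+ 2 by ring.
  rewrite ler_wpM2l// ler_pXn2r ?nnegrE ?addr_ge0 ?norm2_ge0 ?lerD//.
    exact: le_trans (norm2_ge0 _) U.
  exact: le_trans (norm2_ge0 _) V.
have leta0 : 0 <= l * eta1 by rewrite mulr_ge0.
have := @potential_quadratic_form _ (norm2 g) k (norm2 gx) (norm2 gy) e r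
  (L * eta1) (l * eta1).
rewrite !norm2_ge0 gyk aGk => /(_ isT isT isT r14 kb e0 re Leta leta leta0) Q.
have := ler_wpM2l eta0 Q; lra.
Qed.

Section PotentialDecrease.
Variables (R : realType) (d n : nat) (l mu eta1 r : R).
Variable f_ : 'I_n -> 'rV[R]_d -> 'rV[R]_d -> R.
Hypotheses (n0 : (0 < n)%N) (fsmooth : forall i, smooth l (f_ i)).
Hypothesis mu0 : 0 < mu.
Hypothesis fconc : forall x, strongly_concave mu (avg f_ x).
Hypotheses (kappa_ge1 : 1 <= l / mu) (r_ge : 14 * (l / mu) ^+ 2 <= r).
Hypotheses (eta1_ge0 : 0 <= eta1) (eta1_le : l * eta1 * r <= 1 / 8).

Let f := avg f_.

(** Strong concavity bounds the distance of [gradx f] to the gradient of [Phi]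
    by [k = kappa |grady f|]. Since [r >= 14 kappa^2], the ascent gain
    [eta2 |grady f|^2] is at least [14 eta1 k^2]. *)
Lemma potential_decrease (pi : 'S_n) (z0 : 'rV[R]_d * 'rV[R]_d) :
  potential 4 f (vr_epoch f_ eta1 (eta1 * r) pi z0).1
    (vr_epoch f_ eta1 (eta1 * r) pi z0).2
  <= potential 4 f z0.1 z0.2 - eta1 * norm2 (grad (Phi f) z0.1) ^+ 2.
Proof.
have l0 : 0 < l.
  by have := lt_le_trans ltr01 kappa_ge1; rewrite pmulr_lgt0 ?invr_gt0.
have fs : smooth l f by exact: smooth_avg.
have kappa_sq : l / mu <= (l / mu) ^+ 2.
  by rewrite expr2 ler_peMl// (le_trans ler01).
have r14 : 14 <= r by move: r_ge kappa_ge1 kappa_sq; lra.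
have r0 : 0 <= r by lra.
have le_eta1 : 0 <= l * eta1 by rewrite mulr_ge0// ltW.
have leta1_small : l * eta1 <= 1 / 112.
  have : l * eta1 * 14 <= l * eta1 * r by rewrite ler_wpM2l.
  move: eta1_le; lra.
have L0 : 0 <= l * (1 + l / mu).
  by rewrite mulr_ge0 ?(ltW l0)// addr_ge0// (le_trans ler01).
have L_small : l * (1 + l / mu) * eta1 <= 1 / 56.
  rewrite -(@ler_pM2r _ r); last by lra.
  have : l * eta1 * r * (1 + l / mu) <= 1 / 8 * (1 + l / mu).
    by rewrite ler_wpM2r// addr_ge0// (le_trans ler01).
  move: r_ge kappa_ge1 kappa_sq; lra.
have eta_small : l * (eta1 + eta1 * r) <= 1 / 6 by move: eta1_le; lra.
have [ys ysmax] := argmax_exists fs mu0 fconc z0.1.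
set z := vr_epoch _ _ _ _ _.
have xE : z0.1 + (z.1 - z0.1) = z.1 by rewrite addrC subrK.
have yE : z0.2 + (z.2 - z0.2) = z.2 by rewrite addrC subrK.
rewrite (grad_Phi fs mu0 fconc (ltW l0) ysmax) /potential.
have := vr_epoch_drift n0 (ltW l0) fsmooth eta1_ge0 (mulr_ge0 eta1_ge0 r0)
  eta_small (erefl (gradx f z0.1 z0.2)) (erefl (grady f z0.1 z0.2)) pi.
have := epoch_error_ge0 (ltW l0) eta1_ge0 (mulr_ge0 eta1_ge0 r0)
  (gradx f z0.1 z0.2) (grady f z0.1 z0.2).
have := Phi_taylor fs mu0 fconc (z.1 - z0.1) ysmax.
have := smooth_lower_bound fs z0.1 z0.2 (z.1 - z0.1) (z.2 - z0.2).
have := smooth_gradx fs z0.1 z0.2 z0.1 ys; rewrite subrr norm2_0 add0r.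
have := dist_max_le_norm_grad (fconc z0.1)
  (smooth_differentiable_y fs z0.1) (smooth_lip_grady fs z0.1) z0.2 ysmax.
rewrite -/(grady f z0.1 z0.2) xE yE /= -/z.
(* from here on these vectors enter only through the bounds just collected *)
move: (z.1 - z0.1) (z.2 - z0.2) (gradx f z0.1 ys) (gradx f z0.1 z0.2)
  (grady f z0.1 z0.2) (norm2 (z0.2 - ys)) => u v g gx gy D.
move=> muD gxg f_low /andP[_ Phi_up] e0 [uE vE].
have gxk : norm2 (gx - g) <= l / mu * norm2 gy.
  have : l / mu * (mu * D) <= l / mu * norm2 gy.
    by rewrite ler_wpM2l// (le_trans ler01).
  by rewrite mulrA divfK ?gt_eqF//; exact: le_trans.
have gyk : norm2 gy <= l / mu * norm2 gy by rewrite ler_peMl ?norm2_ge0.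
have kb : 14 * (l / mu * norm2 gy) ^+ 2 <= r * norm2 gy ^+ 2.
  by rewrite exprMn mulrA ler_wpM2r ?sqr_ge0.
have re : r * epoch_error l eta1 (eta1 * r) gx gy
    <= 3 / 20 * (norm2 gx + r * norm2 gy).
  have : 0 <= norm2 gx + r * norm2 gy by rewrite addr_ge0 ?mulr_ge0 ?norm2_ge0.
  move=> /ler_wpM2r /(_ _ _ eta1_le); rewrite /epoch_error; lra.
have := drift_decrease eta1_ge0 (ltW l0) L0 r14 e0 gxk gyk kb re L_small
  eta1_le uE vE.
move: f_low Phi_up.
move: (Phi f z.1) (Phi f z0.1) (Phi_inf f) (f z.1 z.2) (f z0.1 z0.2).
move: (dot gx u) (dot gy v) (dot g u) (norm2 u) (norm2 v) (norm2 g).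
by move=> gxu gyv gu nu nv G P1 P0 Pinf f1 f0; lra.
Qed.

Lemma potential_ge0 x y : has_lbound (range (Phi f)) -> 0 <= potential 4 f x y.
Proof.
move=> lb; have fs : smooth l f by exact: smooth_avg.
have := le_Phi fs mu0 fconc x y; rewrite /potential.
have : Phi_inf f <= Phi f x by apply: ge_inf => //; exists x.
lra.
Qed.

(** Telescoping holds along every sequence of permutations, so that averaging
    over the random ones costs nothing. *)
Lemma sum_sqr_grad_le (z0 : 'rV[R]_d * 'rV[R]_d) (pi : nat -> 'S_n) (m : nat) :
  has_lbound (range (Phi f)) ->
  \sum_(0 <= t < m) eta1 *
    norm2 (grad (Phi f) (sgda_vr f_ eta1 (eta1 * r) z0 pi t).1) ^+ 2
  <= potential 4 f z0.1 z0.2.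
Proof.
move=> lb; set z := sgda_vr _ _ _ _ _; rewrite -subr_ge0.
apply: (le_trans (potential_ge0 (z m).1 (z m).2 lb)).
elim: m => [|m IH]; first by rewrite big_nil subr0.
rewrite big_nat_recr //= opprD addrA.
by apply: (le_trans (potential_decrease (pi m) (z m))); rewrite lerD2r.
Qed.

End PotentialDecrease.

(** * Measurability of the iterates *)

Section Measurability.
Variables (disp : measure_display) (Omega : measurableType disp).

Lemma follows_measurable (R : realType) (n : nat) (P : probability Omega R)
    scheme (pi : nat -> Omega -> 'S_n) : follows P scheme pi ->
  forall t s, measurable [set w | pi t w = s].
Proof.
case: scheme => [s0 piE t s|[sigma usigma piE] t s|[upi _] t s].
- have [->|ss0] := pselect (s = s0).
    by rewrite (_ : [set _ | _] = setT)//; apply/seteqP; split => w //= _.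
  rewrite (_ : [set _ | _] = set0)//; apply/seteqP; split => w //=.
  by rewrite piE => /esym.
- rewrite (_ : [set _ | _] = [set w | sigma w = s]); first exact: (usigma s).1.
  by apply/seteqP; split => w /=; rewrite piE.
- exact: (upi t s).1.
Qed.

(** The iterates are discrete random variables: each step splits an event over
    the finitely many values of the new randomness. *)
Lemma measurable_iterates (S : finType) (T : Type) (step : S -> T -> T) (z0 : T)
    (s : nat -> Omega -> S) (z : nat -> Omega -> T) :
    (forall w, z 0 w = z0) ->
    (forall t w, z t.+1 w = step (s t w) (z t w)) ->
    (forall t a, measurable [set w | s t w = a]) ->
  forall t (B : set T), measurable (z t @^-1` B).
Proof.
move=> zE0 zES ms; elim=> [|t IH] B.
  have [Bz|nBz] := pselect (B z0).
    rewrite (_ : _ @^-1` _ = setT)//; apply/seteqP.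
    by split => w _ //=; rewrite zE0.
  rewrite (_ : _ @^-1` _ = set0)//; apply/seteqP.
  by split => w //=; rewrite zE0.
rewrite (_ : _ @^-1` _ = \bigcup_(a in [set: S])
    ([set w | s t w = a] `&` z t @^-1` (step a @^-1` B))).
  apply: fin_bigcup_measurable => [|a _]; first exact: finite_finset.
  by apply: measurableI; [exact: ms|exact: IH].
apply/seteqP; split => w /=; rewrite zES; first by move=> Bz; exists (s t w).
by move=> [a _ [/= <-]].
Qed.

End Measurability.

(** * The convergence rate *)

Theorem mainTheorem1 (R : realType) (d n : nat) (hn : (0 < n)%N)
    (f_ : 'I_n -> 'rV[R]_d -> 'rV[R]_d -> R) (l mu : R)
    (hsmooth : forall i : 'I_n, smooth l (f_ i))
    (hmu : 0 < mu)
    (hconc : forall x : 'rV[R]_d, strongly_concave mu (avg f_ x))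
    (hkappa : 1 <= l / mu)
    (hPhi : has_lbound (range (Phi (avg f_))))
    (lambda eta1 eta2 r : R)
    (hlambda : lambda = 4)
    (heta2_gt0 : 0 < eta2) (heta2 : eta2 <= 1 / (8 * l))
    (hr : 14 * (l / mu) ^+ 2 <= r) (heta1 : eta1 = eta2 / r)
    (x0 y0 : 'rV[R]_d)
    (disp : measure_display) (Omega : measurableType disp)
    (P : probability Omega R)
    (scheme : shuffling n) (pi : nat -> Omega -> 'S_n)
    (hpi : follows P scheme pi) :
  let x (t : nat) (w : Omega) : 'rV[R]_d :=
    (sgda_vr f_ eta1 eta2 (x0, y0) (fun k => pi k w) t).1 in
  let P0 : R := potential lambda (avg f_) x0 y0 in
  [/\ forall T : nat, (0 < T)%N ->
        ((T.+1%:R^-1)%:E *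
           \sum_(0 <= t < T.+1)
             'E_P[(fun w => norm2 (grad (Phi (avg f_)) (x t w)) ^+ 2)%R]
         <= (P0 / (T.+1%:R * eta1))%R%:E)%E,
      (fun T : nat => P0 / (T.+1%:R * eta1))
        =O_\oo (fun T : nat => r * l / T.+1%:R)
    & forall c : R, 0 < c -> c <= eta2 * l -> forall T : nat,
        P0 / (T.+1%:R * eta1) <= (P0 / c) * (r * l / T.+1%:R)].
Proof.
move=> x P0.
have l0 : 0 < l.
  by have := lt_le_trans ltr01 hkappa; rewrite pmulr_lgt0 ?invr_gt0.
have r0 : 0 < r.
  apply: lt_le_trans hr; rewrite mulr_gt0// exprn_gt0//.
  exact: lt_le_trans hkappa.
have eta1_gt0 : 0 < eta1 by rewrite heta1 divr_gt0.
have eta2E : eta2 = eta1 * r by rewrite heta1 divfK ?gt_eqF.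
have eta1_le : l * eta1 * r <= 1 / 8.
  rewrite -mulrA -eta2E -(ler_pdivlMl _ _ l0).
  by apply: (le_trans heta2); rewrite !mul1r invfM mulrC.
have P0_ge0 : 0 <= P0.
  by rewrite /P0 hlambda; exact: (potential_ge0 hn hsmooth hmu hconc).
have T0 T : 0 < T.+1%:R :> R by rewrite ltr0n.
split=> [T _||c c0 cle T].
- pose X t w : R := norm2 (grad (Phi (avg f_)) (x t w)) ^+ 2.
  have X0 t w : (0 <= (X t w)%:E)%E by rewrite lee_fin sqr_ge0.
  have mX t : measurable_fun setT (EFin \o X t).
    apply/measurable_EFinP => _ Y mY; rewrite setTI.
    pose z t w := sgda_vr f_ eta1 eta2 (x0, y0) (fun k => pi k w) t.
    exact: (@measurable_iterates _ _ _ _ (vr_epoch f_ eta1 eta2) (x0, y0) pi z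
      (fun=> erefl) (fun _ _ => erefl) (follows_measurable hpi) t
      ((fun z => norm2 (grad (Phi (avg f_)) z.1) ^+ 2) @^-1` Y)).
  have -> : (P0 / (T.+1%:R * eta1))%:E =
      ((T.+1%:R^-1)%:E * (P0 / eta1)%:E)%E.
    by rewrite -EFinM; congr (_%:E); field; rewrite !gt_eqF.
  rewrite lee_pmul2l ?lte_fin ?invr_gt0//.
  have -> : (\sum_(0 <= t < T.+1) 'E_P[X t] =
      \int[P]_w (\sum_(0 <= t < T.+1) (X t w)%:E))%E.
    rewrite (ge0_integral_sum P measurableT mX (fun t w _ => X0 t w)).
    by apply: eq_bigr => t _; rewrite expectation.unlock.
  have -> : (P0 / eta1)%:E = (\int[P]_w (cst (P0 / eta1)%:E w))%E.
    by rewrite integral_cst//= probability_setT mule1.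
  apply: ge0_le_integral => //.
  + by move=> w _; apply: sume_ge0 => t _; exact: X0.
  + exact: emeasurable_sum.
  move=> w _; rewrite /= sumEFin lee_fin ler_pdivlMr// mulrC mulr_sumr.
  rewrite /P0 hlambda /X /x eta2E.
  exact: (sum_sqr_grad_le hn hsmooth hmu hconc hkappa hr (ltW eta1_gt0) eta1_le
    (x0, y0)).
- apply/eqO_exP; exists (P0 / (eta1 * r * l) + 1).
    by apply: ltr_wpDl => //; apply: divr_ge0 => //; rewrite !mulr_ge0// ltW.
  apply: nearW => T.
  have bound_ge0 : 0 <= P0 / (T.+1%:R * eta1).
    by rewrite divr_ge0// mulr_ge0// ltW.
  have rate_ge0 : 0 <= r * l / T.+1%:R by rewrite divr_ge0// mulr_ge0// ltW.
  have boundE : P0 / (T.+1%:R * eta1) =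
      P0 / (eta1 * r * l) * (r * l / T.+1%:R).
    by field; rewrite !gt_eqF.
  rewrite (ger0_norm bound_ge0) (ger0_norm rate_ge0) boundE.
  by rewrite ler_wpM2r// lerDl.
- have -> : P0 / c * (r * l / T.+1%:R) =
      P0 / (T.+1%:R * eta1) * (eta2 * l / c).
    by rewrite eta2E; field; rewrite !gt_eqF.
  apply: ler_peMr; first by rewrite divr_ge0 ?mulr_ge0// ltW.
  by rewrite ler_pdivlMr// mul1r.
Qed.
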